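(* Let $G$ be a Polish group with ample generics. Then there exists a Polish group $H$ which is contractible (as a topological space) and has ample generics, such that $G$ embeds into $H$ as a topological group.
   Context: A Polish group $G$ has ample generics if for every $n\in\mathbb N$, the diagonal conjugacy action of $G$ on $G^n$, given by $g\cdot(g_1,\dots,g_n)=(gg_1g^{-1},\dots,gg_ng^{-1})$, has a comeager orbit. A subset of a Polish space is comeager if it contains a dense countable intersection of open sets. An embedding of topological groups is an injective group homomorphism which is a homeomorphism onto its image. *)

(* Defs.v *)
From HB Require Import structures.
From mathcomp Require Import all_boot all_order all_algebra.
From mathcomp Require Import boolp classical_sets functions cardinality.
From mathcomp Require Import set_interval reals topology normedtype.
From mathcomp Require Import borel_hierarchy.

Set Implicit Arguments.
Unset Strict Implicit.
Unset Printing Implicit Defensive.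

Import Order.TTheory GRing.Theory Num.Theory.
Import numFieldNormedType.Exports.

Local Open Scope classical_set_scope.

HB.mixin Record Topological_Group_isTopologicalGroup G
    of Topological G & Group G := {
  mulg_continuous : continuous (fun x : G * G => (x.1 * x.2)%g) ;
  invg_continuous : continuous (fun x : G => (x^-1)%g)
}.

(* No separation axiom is built in: Hausdorffness comes from [polish]. *)
#[short(type="topologicalGroupType")]
HB.structure Definition TopologicalGroup :=
  { G of Topological_Group_isTopologicalGroup G & Topological G
       & Group G }.

#[short(type="completeMetricType")]
HB.structure Definition CompleteMetric (R : numDomainType) :=
  { M of Metric R M & Complete M }.

Definition homeomorphism (S T : topologicalType) (f : S -> T) : Prop :=
  continuous f /\
  exists g : T -> S, [/\ cancel f g, cancel g f & continuous g].

Definition separable (T : topologicalType) : Prop :=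
  exists D : set T, countable D /\ dense D.

(* The metric is not part of the data, only the topology of [T] is. *)
Definition polish (R : realType) (T : topologicalType) : Prop :=
  exists M : completeMetricType R,
    separable M /\ exists f : T -> M, homeomorphism f.

Definition comeager (T : topologicalType) (A : set T) : Prop :=
  exists B : set T, [/\ Gdelta B, dense B & B `<=` A].

(* G^n with the product topology is [{ptws 'I_n -> G}]. *)
Definition diag_conj (G : topologicalGroupType) (n : nat) (g : G)
    (x : {ptws 'I_n -> G}) : {ptws 'I_n -> G} :=
  fun i => (g * x i * g^-1)%g.

Definition diag_conj_orbit (G : topologicalGroupType) (n : nat)
    (x : {ptws 'I_n -> G}) : set {ptws 'I_n -> G} :=
  [set diag_conj g x | g in [set: G]].

Definition ample_generics (G : topologicalGroupType) : Prop :=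
  forall n : nat, exists x : {ptws 'I_n -> G}, comeager (diag_conj_orbit x).

Definition contractible (R : realType) (T : topologicalType) : Prop :=
  exists (x0 : T) (F : T * R -> T),
    [/\ {within [set: T] `*` `[0%R, 1%R]%classic, continuous F},
        forall x : T, F (x, 0%R) = x
      & forall x : T, F (x, 1%R) = x0].

(* [g] is the inverse of [f] on [range f]; its values elsewhere are
   irrelevant. *)
Definition homeomorphism_onto_image (S T : topologicalType) (f : S -> T)
    : Prop :=
  continuous f /\
  exists g : T -> S, cancel f g /\ {within range f, continuous g}.

Definition topological_group_embedding (G H : topologicalGroupType)
    (f : G -> H) : Prop :=
  [/\ {morph f : x y / (x * y)%g >-> (x * y)%g},
      injective f
    & homeomorphism_onto_image f].

(* Main.v *)
(* G embeds as the constants into L^0([0, 1]; G), the group of measurable maps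
   [0, 1] -> G modulo equality almost everywhere with the topology of convergence
   in measure, which is contracted by setting a map to 1 on [0, t[ and letting t
   go from 0 to 1. Measurability is avoided altogether: elements are the
   limits, for the Lebesgue outer measure, of step functions. Such a limit takes
   its values in a totally bounded set outside a small set, so composition with a
   continuous map is continuous.

   If the orbit of x in G^n is comeager, then by Baire category y in G^n close to
   a.x can be approximated by points b.x with b close to a. Applied value by value
   to step functions, this gives the same property for the constant map x and the
   action of L^0 at every step function; its orbit is also dense. A continuous
   image of a complete separable metric space with dense range and this local
   density at a dense sequence of points is comeager, by successive
   approximation, so no measurable selection is required. *)
Require Import Defs.
From HB Require Import structures.
From mathcomp Require Import all_boot all_order all_algebra.
From mathcomp Require Import boolp classical_sets functions cardinality.
From mathcomp Require Import reals ereal topology normedtype.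
From mathcomp Require Import sequences measure lebesgue_measure borel_hierarchy.
From mathcomp Require Import lra.

Set Implicit Arguments.
Unset Strict Implicit.
Unset Printing Implicit Defensive.

Import Order.TTheory GRing.Theory Num.Theory.
Import numFieldNormedType.Exports.

Local Open Scope classical_set_scope.
Local Open Scope ring_scope.

(** * Complete metrics and Baire category *)

Section HalfPowers.
Context {R : realType}.

Lemma halfpow_gt0 k : 0 < 2 ^- k :> R.
Proof. by rewrite invr_gt0 exprn_gt0. Qed.

Lemma halfpowS k : 2 ^- k = 2 * 2 ^- k.+1 :> R.
Proof. by rewrite exprS invfM mulrA divff ?mul1r// pnatr_eq0. Qed.

Lemma halfpow_lt (e : R) : 0 < e -> exists k, 2 ^- k < e.
Proof.
move=> e0; exists (Num.bound e^-1).
rewrite -[ltRHS]invrK ltf_pV2 ?posrE ?invr_gt0 ?exprn_gt0//.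
have := @archi_boundP R e^-1 (ltW _); rewrite invr_gt0 => /(_ e0) /lt_trans; apply.
by rewrite -natrX ltr_nat ltn_expl.
Qed.

Lemma halfpow_le m n : (m <= n)%N -> 2 ^- n <= 2 ^- m :> R.
Proof.
move=> mn; rewrite lef_pV2 ?posrE ?exprn_gt0//.
by rewrite ler_weXn2l// ler1n.
Qed.

End HalfPowers.

Section MetricsAsFunctions.
Context {R : realType}.

(* Completeness is only required for sequences with geometrically decreasing
   steps, which is equivalent to the usual notion. *)
Record complete_metric (T : Type) (d : T -> T -> R) : Prop := CompleteMetricFun {
  cm_xx : forall x, d x x = 0 ;
  cm_eq : forall x y, d x y = 0 -> x = y ;
  cm_sym : forall x y, d x y = d y x ;
  cm_tri : forall y x z, d x z <= d x y + d y z ;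
  cm_lim : forall u : nat -> T, (forall k, d (u k) (u k.+1) <= 2 ^- k) ->
    exists l, forall k, d (u k) l <= 2 * 2 ^- k }.

Definition metrizes (T : topologicalType) (d : T -> T -> R) : Prop :=
  forall (x : T) (A : set T),
    nbhs x A <-> exists2 e, 0 < e & forall y, d x y < e -> A y.

Definition dense_seq (T : Type) (d : T -> T -> R) (u : nat -> T) : Prop :=
  forall x e, 0 < e -> exists k, d x (u k) < e.

Lemma cm_ge0 (T : Type) (d : T -> T -> R) : complete_metric d ->
  forall x y, 0 <= d x y.
Proof.
by move=> dM x y; have := cm_tri dM y x x; rewrite (cm_xx dM) (cm_sym dM y); lra.
Qed.

Lemma geometric_steps (T : Type) (d : T -> T -> R) (u : nat -> T) :
    (forall x, d x x = 0) -> (forall y x z, d x z <= d x y + d y z) ->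
    (forall k, d (u k) (u k.+1) <= 2 ^- k) ->
  forall k m, d (u k) (u (k + m)%N) <= 2 * 2 ^- k.
Proof.
move=> dxx tri uS k m; elim: m k => [|m IH] k.
  by rewrite addn0 dxx mulr_ge0// ltW// halfpow_gt0.
rewrite (le_trans (tri (u k.+1) _ _))// -addSnnS.
have := uS k; have := IH k.+1; rewrite (halfpowS k); lra.
Qed.

Lemma mdist_complete_metric (M : completeMetricType R) :
  complete_metric (@mdist R M).
Proof.
split; [exact: mdistxx|exact: mdist_positivity|exact: metric_sym| |].
  by move=> y x z; exact: metric_triangle.
move=> u uS.
have uk := geometric_steps (@mdistxx R M) (fun y x z => metric_triangle x y z) uS.
have /cauchy_cvg/cvg_ex[l ul] : cauchy (u @ \oo).
  apply: cauchy_exP => e e0.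
  have [k ke] : exists k, 2 ^- k < e / 2 by apply: halfpow_lt; lra.
  exists (u k); exists k => // m /= km; rewrite ballEmdist/=.
  by have := uk k (m - k)%N; rewrite subnKC//; lra.
exists l => k; apply/ler_addgt0Pr => e e0.
have [n _ /(_ (n + k)%N (leq_addr _ _))] := ul _ (nbhsx_ballx l e e0).
rewrite /= ballEmdist/= => le.
have := uk k n; rewrite addnC => ukn.
have := metric_triangle (u k) (u (n + k)%N) l.
by rewrite metric_sym in le; lra.
Qed.

Lemma mdist_metrizes (M : metricType R) : metrizes (@mdist R M).
Proof.
move=> x A; rewrite -nbhs_ballE; split => -[e e0 xA]; exists e => // y.
  by move=> xy; apply: xA; rewrite ballEmdist.
by rewrite ballEmdist; exact: xA.
Qed.

Lemma separable_dense_seq (T : topologicalType) (d : T -> T -> R) (x0 : T) :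
  metrizes d -> separable T -> exists u, dense_seq d u.
Proof.
move=> dT [D [/pfcard_geP[D0|[f]] Dd]].
  by have [] := Dd _ (ex_intro _ x0 I) openT; rewrite D0 => x [].
exists f => x e e0.
have [y []] : ([set y | d x y < e]^° `&` D) !=set0.
  apply: Dd; last exact: open_interior.
  by exists x; apply/dT; exists e.
move=> /interior_subset/= xye Dy.
by have [k _ fk] := 'surj_f Dy; exists k; rewrite fk.
Qed.

Lemma dense_seq_separable (T : topologicalType) (d : T -> T -> R) (u : nat -> T) :
  metrizes d -> dense_seq d u -> separable T.
Proof.
move=> dT du; exists (range u); split; first exact: card_image_le.
move=> O [x Ox] oO; have /dT[e e0 xO] := open_nbhs_nbhs (conj oO Ox).
by have [k /xO Ok] := du x e e0; exists (u k); split => //; exists k.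
Qed.

(** The metric of [M] is pulled back along the homeomorphism, and so is a dense sequence. *)
Lemma polish_metric (T : topologicalType) : polish R T ->
  exists d : T -> T -> R,
    [/\ complete_metric d, metrizes d & exists u, dense_seq d u].
Proof.
move=> [M [sM [f [fc [g [fgK gfK gc]]]]]].
have dM := mdist_complete_metric M; have tM := @mdist_metrizes M.
exists (fun x y => mdist (f x) (f y)); split.
- split.
  + by move=> x; exact: cm_xx dM _.
  + by move=> x y /(cm_eq dM)/(can_inj fgK).
  + by move=> x y; exact: cm_sym dM _ _.
  + by move=> y x z; exact: cm_tri dM _ _ _.
  + by move=> u /(cm_lim dM (u := f \o u))[l ul]; exists (g l); rewrite gfK.
- move=> x A; split=> [nA|[e e0 xA]].
    have := gc (f x) A; rewrite fgK => /(_ nA) /tM[e e0 H].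
    by exists e => // y /H; rewrite /= fgK.
  have -> : A = f @^-1` (g @^-1` A) by apply/seteqP; split=> y /=; rewrite fgK.
  apply: fc; apply/tM; exists e => // z.
  by rewrite -{1}(gfK z); exact: xA.
- have [D [cD dD]] := sM.
  have [u du] := separable_dense_seq (f (g point)) tM sM.
  exists (g \o u) => x e e0; have [k xk] := du (f x) e e0.
  by exists k; rewrite /= gfK.
Qed.

End MetricsAsFunctions.

(** Dependent choice with an invariant [P] that may vary with the stage; it builds all the
    successive approximations below. *)
Lemma dep_choice (T : Type) (P : nat -> T -> Prop) (Q : nat -> T -> T -> Prop)
    (x0 : T) :
    P 0%N x0 -> (forall k x, P k x -> exists y, P k.+1 y /\ Q k x y) ->
  exists u : nat -> T, u 0%N = x0 /\ forall k, P k (u k) /\ Q k (u k) (u k.+1).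
Proof.
move=> P0 PQ.
have H (s : nat * T) : exists y, P s.1 s.2 -> P s.1.+1 y /\ Q s.1 s.2 y.
  by have [/PQ[y]|nP] := pselect (P s.1 s.2); [exists y|exists x0].
have [f fP] := choice H.
pose u := fix u k := if k is k'.+1 then f (k', u k') else x0.
have Pu k : P k (u k) by elim: k => // k /(fP (k, u k))[].
by exists u; split=> // k; split=> //; have [] := fP (k, u k) (Pu k).
Qed.

Section BaireCategory.
Context {R : realType} (T : topologicalType) (d : T -> T -> R).
Hypotheses (dM : complete_metric d) (dT : metrizes d).

(** A state is a centre with a radius. [Q] puts each closed ball inside the previous one and inside
    [O k]; the bounds on the radii in [P] give the centres geometric steps. *)
Lemma complete_metric_Baire (O : nat -> set T) :
  (forall k, open (O k)) -> (forall k, dense (O k)) -> dense (\bigcap_k O k).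
Proof.
move=> oO dO W [x0 Wx0] oW.
have /dT[e0 e0_gt0 x0W] := open_nbhs_nbhs (conj oW Wx0).
pose P (k : nat) (s : T * R) := 0 < s.2 <= 2 ^- k.
pose Q (k : nat) (s t : T * R) := forall y, d t.1 y <= t.2 -> O k y /\ d s.1 y <= s.2.
(* The closed ball of radius e0/2 stays in [W]; the bound 1 is the one that [P] asks for at stage
   0. *)
have [|k [x r] /andP[/= r0 rk]|u [u0 uP]] := @dep_choice _ P Q (x0, Num.min (e0 / 2) 1).
- by rewrite /P/= expr0 invr1 lt_min ge_min lexx orbT !andbT ltr01 divr_gt0.
- have [] := dO k [set y | d x y < r]^°.
  + by exists x; apply/dT; exists r.
  + exact: open_interior.
  + move=> y [nxy Oy].
    have nOy : nbhs y (O k `&` [set z | d x z < r]).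
      by apply: filterI nxy; exact: open_nbhs_nbhs.
    have /dT[e egt0 yO] := nOy.
    exists (y, Num.min (e / 2) (2 ^- k.+1)); split.
      by rewrite /P/= lt_min ge_min lexx orbT halfpow_gt0 divr_gt0.
    move=> z; rewrite le_min => /andP[ze _].
    by have [|Oz xz] := yO z; [rewrite (le_lt_trans ze)//; lra|split=> //; exact: ltW].
have sub k m y : d (u (k + m)%N).1 y <= (u (k + m)%N).2 -> d (u k).1 y <= (u k).2.
  elim: m k => [|m IH] k; first by rewrite addn0.
  by rewrite addnS => uy; apply: IH; have [_ /(_ y uy)[]] := uP (k + m)%N.
have uS k : d (u k).1 (u k.+1).1 <= 2 ^- k.
  have [/andP[_ uk]] := uP k; move/(_ (u k.+1).1); rewrite (cm_xx dM).
  have [/andP[uk0 _] _] := uP k.+1; move/(_ (ltW uk0)) => [_] /le_trans; exact.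
have [l ul] := cm_lim dM (u := fun k => (u k).1) uS.
(* The limit lies in the k-th closed ball because all later centres do and they approach it. *)
have ll k : d (u k).1 l <= (u k).2.
  apply/ler_addgt0Pr => e egt0.
  have [j je] : exists j, 2 ^- j < e / 2 by apply: halfpow_lt; lra.
  have := cm_tri dM (u (k + j)%N).1 (u k).1 l.
  have := sub k j (u (k + j)%N).1; rewrite (cm_xx dM).
  have [/andP[ukj _] _] := uP (k + j)%N; move/(_ (ltW ukj)).
  by have := ul (k + j)%N; have := @halfpow_le R j (k + j) (leq_addl _ _); lra.
exists l; split.
  apply: x0W; have := ll 0%N; rewrite u0/= le_min => /andP[+ _]; lra.
by move=> k _; have [_ /(_ l (ll k.+1))[]] := uP k.
Qed.

End BaireCategory.

Section SupMetric.
Context {R : realType} {n : nat} (T : Type) (d : T -> T -> R).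

(** The starting value 0 is the distance on the one-point space for n = 0, and does not change a
    maximum of non-negative distances. *)
Definition dsup (x y : 'I_n -> T) : R := \big[Num.max/0]_(i < n) d (x i) (y i).

Lemma dsup_lt e x y : 0 < e -> dsup x y < e <-> forall i, d (x i) (y i) < e.
Proof.
move=> e0; split=> [/bigmax_ltP[_ xy] i|xy]; first exact: xy.
by apply/bigmax_ltP; split.
Qed.

Lemma dsup_le e x y : 0 <= e -> dsup x y <= e <-> forall i, d (x i) (y i) <= e.
Proof.
move=> e0; split=> [/bigmax_leP[_ xy] i|xy]; first exact: xy.
by apply/bigmax_leP; split.
Qed.

Lemma dsup_ge0 x y : 0 <= dsup x y.
Proof. exact: bigmax_ge_id. Qed.

Lemma dsup_ub x y i : d (x i) (y i) <= dsup x y.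
Proof. exact: le_bigmax. Qed.

Lemma dsup_complete_metric : complete_metric d -> complete_metric dsup.
Proof.
move=> dM; split.
- move=> x; apply/le_anti; rewrite dsup_ge0 andbT.
  by apply/dsup_le => // i; rewrite (cm_xx dM).
- move=> x y xy0; apply/funext => i; apply: (cm_eq dM); apply/le_anti.
  by rewrite (cm_ge0 dM) andbT -xy0 dsup_ub.
- by move=> x y; apply: eq_bigr => i _; exact: cm_sym.
- move=> y x z; apply/dsup_le; first by rewrite addr_ge0 ?dsup_ge0.
  by move=> i; rewrite (le_trans (cm_tri dM (y i) _ _))// lerD// dsup_ub.
- move=> u uS.
  have H i : exists l, forall k, d (u k i) l <= 2 * 2 ^- k.
    apply: (cm_lim dM (u := fun k => u k i)) => k.
    exact: le_trans (dsup_ub _ _ i) (uS k).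
  have [l lP] := choice H; exists l => k.
  by apply/dsup_le => [|i]; [rewrite mulr_ge0// ltW// halfpow_gt0|exact: lP].
Qed.

End SupMetric.

Lemma dsup_metrizes (R : realType) (n : nat) (T : topologicalType)
    (d : T -> T -> R) : complete_metric d -> metrizes d ->
  @metrizes R {ptws 'I_n -> T} (dsup d).
Proof.
move=> dM dT x A; split=> [|[e e0 xA]].
  (* The product topology is initial for the projections, so it suffices that the filter of [dsup]
     balls converges in each coordinate. *)
  pose F : set_system {ptws 'I_n -> T} :=
    filter_from [set e : R | 0 < e] (fun e => [set y | dsup d x y < e]).
  have FF : Filter F.
    apply: filter_from_filter; first by exists 1 => /=.
    move=> a b /= a0 b0; exists (Num.min a b) => /=; first by rewrite lt_min a0.
    by move=> y /=; rewrite lt_min => /andP[].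
  suff : F --> x by move=> /(_ A) Fx /Fx [e e0 xA]; exists e.
  apply/cvg_sup => i U [V [[W oW <-] Wx WU]].
  have /dT[e e0 xW] := open_nbhs_nbhs (conj oW Wx).
  exists e => //= y xy; apply: WU; apply: xW.
  exact: le_lt_trans (dsup_ub _ _ _ _) xy.
have : \forall y \near (x : {ptws 'I_n -> T}), forall i : 'I_n, d (x i) (y i) < e.
  apply: (@filter_forall _ _ (fun i (y : {ptws 'I_n -> T}) => d (x i) (y i) < e)
    _ (nbhs_filter x)) => i.
  have : nbhs (x i) [set y | d (x i) y < e] by apply/dT; exists e.
  exact: (@proj_continuous _ (fun _ : 'I_n => T) i x).
by apply: (@filterS _ _ (nbhs_filter x)) => y xy; apply: xA; apply/dsup_lt.
Qed.

(** * A criterion for the range of a continuous map to be comeager *)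

Section ComeagerRange.
Context {R : realType} (M : Type) (Y : topologicalType).
Context (dM : M -> M -> R) (dY : Y -> Y -> R) (u : nat -> M) (p : M -> Y).
Hypotheses (cM : complete_metric dM) (du : dense_seq dM u).
Hypotheses (cY : complete_metric dY) (mY : metrizes dY).
Hypothesis p_cont : forall h (e : R), 0 < e ->
  exists2 r : R, 0 < r & forall h', dM h h' < r -> dY (p h) (p h') < e.
Hypothesis p_dense : forall y (e : R), 0 < e -> exists h, dY y (p h) < e.

(** This is the closure of the image under [p] of the open ball of radius 2^-n around [u j]. *)
Let C (n j : nat) : set Y :=
  [set y | forall e : R, 0 < e -> exists2 h, dM (u j) h < 2 ^- n & dY y (p h) < e].

Hypothesis p_open : forall n j, nbhs (p (u j)) (C n j).

(** These open sets encode a refinement step: a point interior to [C n j] and in the stage of (n, j)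
    is interior to [C n.+1 i] for some [u i] in the ball of radius 2^-n around [u j]. The stage
    [None] provides the start. *)
Let stage (k : option (nat * nat)) : set Y :=
  if k is Some (n, j) then
    ~` closure (C n j)^° `|`
    \bigcup_(i in [set i | dM (u j) (u i) < 2 ^- n]) (C n.+1 i)^°
  else \bigcup_j (C 0 j)^°.

Let open_stage k : open (stage k).
Proof.
case: k => [[n j]|]; last by apply: bigcup_open => i _; exact: open_interior.
apply: openU; first by apply: closed_openC; exact: closed_closure.
by apply: bigcup_open => i _; exact: open_interior.
Qed.

Let near_image h (A : set Y) (e : R) : 0 < e -> nbhs (p h) A ->
  exists2 i, dM h (u i) < e & A (p (u i)).
Proof.
move=> e0 /mY[a a0 hA]; have [r r0 hr] := p_cont h a0.
have er0 : 0 < Num.min e r by rewrite lt_min e0.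
have [i] := du h er0.
by rewrite lt_min => /andP[ie ir]; exists i => //; apply: hA; exact: hr.
Qed.

Let dense_stage k : dense (stage k).
Proof.
move=> W [y Wy] oW; case: k => [[n j]|].
- have [[z [Wz Cz]]|WC] := pselect (W `&` (C n j)^° !=set0); last first.
    exists y; split=> //; left => /(_ W (open_nbhs_nbhs (conj oW Wy))).
    by rewrite setIC.
  have oWC : open (W `&` (C n j)^°) by apply: openI => //; exact: open_interior.
  have /mY[e e0 zWC] := open_nbhs_nbhs (conj oWC (conj Wz Cz)).
  have [h uh zh] := interior_subset Cz e e0.
  have hWC := open_nbhs_nbhs (conj oWC (zWC _ zh)).
  (* The room left between [h] and the boundary of the ball keeps [u i] inside it. *)
  have [|i hi [Wi _]] := near_image (e := 2 ^- n - dM (u j) h) _ hWC.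
    by rewrite subr_gt0.
  exists (p (u i)); split => //; right; exists i => /=; last exact: p_open.
  by have := cM.(cm_tri) h (u j) (u i); lra.
- have /mY[e e0 yW] := open_nbhs_nbhs (conj oW Wy).
  have [h yh] := p_dense y e0.
  have [i _ Wi] := near_image ltr01 (open_nbhs_nbhs (conj oW (yW _ yh))).
  by exists (p (u i)); split => //; exists i => //; exact: p_open.
Qed.

(* A point z of all the stages is reached by following points u j whose images
   cluster at z: z stays in the interior of the closure of the image of the
   ball of radius 2^-n around the n-th one. *)
Lemma comeager_range : comeager (range p).
Proof.
pose F k := if unpickle k is Some s then stage s else setT.
have oF k : open (F k) by rewrite /F; case: unpickle => //; exact: openT.
have dF k : dense (F k).
  by rewrite /F; case: unpickle => // W W0 _; rewrite setIT.
exists (\bigcap_k F k); split.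
- by exists F.
- by apply: (complete_metric_Baire cY mY).
move=> z zF.
have zS s : stage s z by have := zF (pickle s) I; rewrite /F pickleK.
have [j0 _ zj0] := zS None.
pose P n j := (C n j)^° z.
pose Q n j i := dM (u j) (u i) < 2 ^- n.
have [//|n j Pj|v [_ vP]] := @dep_choice _ P Q j0.
  have [/(_ (@subset_closure _ (C n j)^° z Pj))//|[i ji Pi]] := zS (Some (n, j)).
  by exists i.
have [|h vh] := cm_lim cM (u := u \o v).
  by move=> k; have [_ /ltW] := vP k.
exists h => //; apply/esym/(cm_eq cY)/le_anti; rewrite (cm_ge0 cY) andbT.
apply/ler_addgt0Pr => e e0; rewrite add0r.
have [|r r0 hr] := @p_cont h (e / 2); first by rewrite divr_gt0.
(* The limit [h] is within 2 * 2^-n of [u (v n)], and [g] within 2^-n, hence the factor 3. *)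
have [|n nr] := @halfpow_lt R (r / 3); first by rewrite divr_gt0.
have [/interior_subset/(_ (e / 2)) []] := vP n; first by rewrite divr_gt0.
move=> g vg zg _; have hg : dM h g < r.
  have := cm_tri cM (u (v n)) h g; rewrite (cm_sym cM h (u _)).
  by have := vh n; rewrite /=; lra.
have := cm_tri cY (p g) z (p h); rewrite (cm_sym cY (p g)).
by have := hr _ hg; lra.
Qed.

End ComeagerRange.

(** * Limits in measure of step functions *)

Section SmallSets.
Context {R : realType}.
Implicit Types (A B : set R) (e : R).

(* The library's Lebesgue measure is an outer measure on arbitrary sets, so A
   need not be measurable. *)
Definition small A e : Prop :=
  (lebesgue_measure (A `&` `[0%R, 1%R[ : set (measurableTypeR R)) <= e%:E)%E.

Lemma small_sub A B e : A `<=` B -> small B e -> small A e.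
Proof.
by move=> AB; apply: le_trans; apply: le_mu_ext => x [/AB].
Qed.

Lemma small_le A a b : a <= b -> small A a -> small A b.
Proof. by move=> ab /le_trans; apply; rewrite lee_fin. Qed.

Lemma small0 e : 0 <= e -> small set0 e.
Proof. by move=> e0; rewrite /small set0I measure0 lee_fin. Qed.

Lemma small_full_ge e : small setT e -> 1 <= e.
Proof.
by rewrite /small setTI lebesgue_measure_itv/= lte_fin ltr01 sube0 lee_fin.
Qed.

Lemma small1 A : small A 1.
Proof.
apply: (@small_sub _ setT) => //.
by rewrite /small setTI lebesgue_measure_itv/= lte_fin ltr01 sube0.
Qed.

(** The weights 2^-(k+1) sum to 1, so this is countable subadditivity of the outer measure. *)
Lemma small_bigcup (A : nat -> set R) e : 0 <= e ->
  (forall k, small (A k) (e * 2 ^- k.+1)) -> small (\bigcup_k A k) e.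
Proof.
move=> e0 Ae; rewrite /small setI_bigcupl.
apply: (le_trans (mu_ext_sigma_subadditive _ _)) => //.
apply: le_trans (epsilon_trick0 xpredT e0).
apply: lee_nneseries => [k _ _|k _]; first exact: mu_ext_ge0.
by rewrite natrX; exact: Ae.
Qed.

Lemma smallU A B a b : small A a -> small B b -> small (A `|` B) (a + b).
Proof.
move=> Aa Bb; rewrite /small setIUl EFinD.
by apply: le_trans (leeD Aa Bb); exact: outer_measureU2.
Qed.

Lemma small_itv s t : s <= t -> small [set x | s <= x < t] (t - s).
Proof.
move=> st; apply: (@le_trans _ _ (lebesgue_measure (`[s, t[%classic : set (measurableTypeR R)))).
  by apply: le_mu_ext => x [/= xst _]; rewrite in_itv.
rewrite lebesgue_measure_itv/= lte_fin; case: ifPn => //.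
by rewrite lee_fin subr_ge0.
Qed.

Lemma small_limit A e : (forall r, 0 < r -> small A (e + r)) -> small A e.
Proof. by move=> Ae; apply/lee_addgt0Pr => r r0; rewrite -EFinD; exact: Ae. Qed.

End SmallSets.

Section CloseFunctions.
Context {R : realType} (T : Type) (d : T -> T -> R).
Hypothesis dM : complete_metric d.
Implicit Types (f g h : R -> T) (e a b : R).

(** One parameter bounds both the distance and the size of the exceptional set, which gives the
    triangle inequality in additive form. *)
Definition fclose e f g : Prop := small [set x | e < d (f x) (g x)] e.

(** Written as a set, so that [eqv f] is the equivalence class of [f]. *)
Definition eqv f : set (R -> T) := [set g | forall e, 0 < e -> fclose e f g].

Lemma fclose_refl e f : 0 <= e -> fclose e f f.
Proof.
move=> e0; apply: (@small_sub _ _ set0); last exact: small0.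
by move=> x /=; rewrite (cm_xx dM) ltNge e0.
Qed.

Lemma fclose_sym e f g : fclose e f g -> fclose e g f.
Proof. by apply: small_sub => x /=; rewrite (cm_sym dM). Qed.

Lemma fclose_le a b f g : a <= b -> fclose a f g -> fclose b f g.
Proof.
move=> ab /(small_le ab); apply: small_sub => x; exact: le_lt_trans.
Qed.

Lemma fclose_tri a b f g h : fclose a f g -> fclose b g h -> fclose (a + b) f h.
Proof.
move=> fg gh; apply: (small_sub _ (smallU fg gh)) => x /= fh.
apply: contrapT => /not_orP[/negP + /negP]; rewrite -!leNgt => fga ghb.
by have := cm_tri dM (g x) (f x) (h x); lra.
Qed.

Lemma fclose1 f g : fclose 1 f g. Proof. exact: small1. Qed.

Lemma eqv_refl f : eqv f f.
Proof. by move=> e /ltW; exact: fclose_refl. Qed.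

Lemma eqv_sym f g : eqv f g -> eqv g f.
Proof. by move=> fg e /fg; exact: fclose_sym. Qed.

Lemma eqv_tri f g h : eqv f g -> eqv g h -> eqv f h.
Proof.
move=> fg gh e e0; rewrite (splitr e).
by apply: fclose_tri; [apply: fg|apply: gh]; rewrite divr_gt0.
Qed.

(* The Ky Fan metric of convergence in measure. *)
Definition ldist f g : R := inf [set e | 0 <= e /\ fclose e f g].

Let ldist_inf f g : has_inf [set e | 0 <= e /\ fclose e f g].
Proof. by split; [exists 1; split => //; exact: fclose1|exists 0 => e []]. Qed.

Lemma ldist_lt e f g : ldist f g < e -> fclose e f g.
Proof.
rewrite -subr_gt0 => /(inf_adherent)-/(_ _ (ldist_inf f g))[a [a0 ag]].
by rewrite -/(ldist f g) addrC subrK => /ltW ae; exact: fclose_le ag.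
Qed.

Lemma ldist_le e f g : 0 <= e -> fclose e f g -> ldist f g <= e.
Proof. by move=> e0 fg; apply: ge_inf; [have [] := ldist_inf f g|split]. Qed.

Lemma ldist_ge0 f g : 0 <= ldist f g.
Proof. by apply: lb_le_inf; [have [] := ldist_inf f g|move=> e []]. Qed.

Lemma ldist_eqv f g : ldist f g = 0 <-> eqv f g.
Proof.
split=> [fg0 e e0|fg]; first by apply: ldist_lt; rewrite fg0.
apply/le_anti; rewrite ldist_ge0 andbT; apply/ler_addgt0Pr => e e0.
by rewrite add0r; apply: ldist_le; [exact: ltW|exact: fg].
Qed.

Lemma ldist_sym f g : ldist f g = ldist g f.
Proof.
by congr inf; apply/seteqP; split => e /= [e0 /fclose_sym].
Qed.

Lemma ldist_tri g f h : ldist f h <= ldist f g + ldist g h.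
Proof.
apply/ler_addgt0Pr => e e0.
have fg : fclose (ldist f g + e / 2) f g by apply: ldist_lt; lra.
have gh : fclose (ldist g h + e / 2) g h by apply: ldist_lt; lra.
have -> : ldist f g + ldist g h + e = (ldist f g + e / 2) + (ldist g h + e / 2) by lra.
apply: ldist_le (fclose_tri fg gh).
by have := ldist_ge0 f g; have := ldist_ge0 g h; lra.
Qed.

(** A Borel-Cantelli argument: outside the union over m of the sets where the step k + m exceeds
    2^-(k+m), of outer measure at most 2 * 2^-k, the sequence of values has geometric steps and
    converges. *)
Lemma fclose_limit (F : nat -> R -> T) :
    (forall k, fclose (2 ^- k) (F k) (F k.+1)) ->
  exists f, forall k, fclose (2 * 2 ^- k) (F k) f.
Proof.
move=> FS; pose P k x l := forall m, (k <= m)%N -> d (F m x) l <= 2 * 2 ^- m.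
have Puniq x k k' l l' : P k x l -> P k' x l' -> l = l'.
  move=> Pl Pl'; apply/(cm_eq dM)/le_anti; rewrite (cm_ge0 dM) andbT.
  apply/ler_addgt0Pr => e e0; rewrite add0r.
  have [|m me] := @halfpow_lt R (e / 4); first by lra.
  pose N := maxn m (maxn k k').
  have kN : (k <= N)%N by rewrite !leq_max leqnn orbT.
  have kN' : (k' <= N)%N by rewrite !leq_max leqnn !orbT.
  have := Pl N kN; have := Pl' N kN'.
  have := @halfpow_le R m N (leq_maxl _ _).
  by have := cm_tri dM (F N x) l l'; rewrite (cm_sym dM l (F N x)); lra.
have good k x : (forall m, d (F (k + m)%N x) (F (k + m).+1 x) <= 2 ^- (k + m)) ->
    exists l, P k x l.
  move=> Fx; have [|l ul] := cm_lim dM (u := fun m => F (maxn k m) x).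
    move=> m; have [km|mk] := leqP k m.
      by rewrite (maxn_idPr (leqW km)); have := Fx (m - k)%N; rewrite subnKC.
    by rewrite (maxn_idPl mk) (cm_xx dM) ltW ?halfpow_gt0.
  by exists l; rewrite /P => m km; have := ul m; rewrite (maxn_idPr km).
(* The limit must be chosen independently of k; [F 0 x] is a default where no [P k x] has a
   limit. *)
have lim x : exists l, forall l', (exists k, P k x l') -> l' = l.
  have [[l [k Pl]]|nP] := pselect (exists l k, P k x l).
    by exists l => l' [k' Pl']; exact: Puniq Pl' Pl.
  by exists (F 0%N x) => l' [k Pl]; exfalso; apply: nP; exists l', k.
have [f fP] := choice lim; exists f => k.
pose B m := [set x | 2 ^- (k + m) < d (F (k + m)%N x) (F (k + m).+1 x)].
have sB : small (\bigcup_m B m) (2 * 2 ^- k).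
  apply: small_bigcup => [|m]; first by rewrite mulr_ge0// ltW// halfpow_gt0.
  suff -> : 2 * 2 ^- k * 2 ^- m.+1 = 2 ^- (k + m) :> R by exact: FS.
  by rewrite (mulrC 2) -mulrA -halfpowS exprD invfM.
apply: small_sub sB => x /= kf; apply: contrapT => nB.
have [|l Pl] := good k x.
  by move=> m; rewrite leNgt; apply/negP => Bm; apply: nB; exists m.
by have := Pl k (leqnn k); rewrite (fP x l (ex_intro _ k Pl)) leNgt kf.
Qed.

End CloseFunctions.

Section StepFunctions.
Context {R : realType}.

(** The value at x depends only on which of finitely many thresholds exceed x, so f is constant on
    the half-open intervals that they cut out. *)
Definition step (T : Type) (f : R -> T) : Prop :=
  exists l : seq R, forall x y,
    (forall t, t \in l -> (x < t) = (y < t)) -> f x = f y.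

Lemma step_cst (T : Type) (c : T) : step (fun=> c).
Proof. by exists [::]. Qed.

Lemma step_comp (T U : Type) (p : T -> U) f : step f -> step (p \o f).
Proof. by move=> [l lf]; exists l => x y /lf /= ->. Qed.

Lemma step_family (T : Type) n (f : 'I_n -> R -> T) :
  (forall i, step (f i)) -> step (fun x i => f i x).
Proof.
move=> /choice[l lf]; exists (flatten [seq l i | i <- enum 'I_n]) => x y xy.
apply/funext => i; apply: lf => t ti; apply: xy.
by apply/flatten_mapP; exists i => //; rewrite mem_enum.
Qed.

Lemma step2 (T U V : Type) (p : T -> U -> V) f g :
  step f -> step g -> step (fun x => p (f x) (g x)).
Proof.
move=> [l lf] [m mg]; exists (l ++ m) => x y xy.
by congr p; [apply: lf|apply: mg] => t tl; apply: xy; rewrite mem_cat tl ?orbT.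
Qed.

Lemma step_cut (T : Type) (t : R) (c : T) f :
  step f -> step (fun x => if x < t then c else f x).
Proof.
move=> [l lf]; exists (t :: l) => x y xy.
rewrite -(xy t (mem_head _ _)); case: ifP => // _.
by apply: lf => s sl; apply: xy; rewrite inE sl orbT.
Qed.

Definition cuts n (l : n.-tuple R) (x : R) : n.-tuple bool :=
  [tuple x < tnth l i | i < n].

(** Boolean tuples form a finite type, so f reads its values from a finite table; tuples that no
    point realizes get the default [f 0]. *)
Lemma step_cuts (T : Type) (f : R -> T) : step f ->
  exists n (l : n.-tuple R) (w : n.-tuple bool -> T), forall x, f x = w (cuts l x).
Proof.
move=> [l lf]; exists (size l), (in_tuple l).
have H (m : (size l).-tuple bool) :
    exists y, forall x, cuts (in_tuple l) x = m -> f x = y.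
  have [[z <-]|nm] := pselect (exists z, cuts (in_tuple l) z = m); last first.
    by exists (f 0) => x xm; exfalso; apply: nm; exists x.
  exists (f z) => x xz; apply: lf => t /(nthP 0)[i il <-].
  have := congr1 (fun m : (size l).-tuple bool => tnth m (Ordinal il)) xz.
  by rewrite !tnth_mktuple !(tnth_nth 0).
by have [w wP] := choice H; exists w => x; exact: wP.
Qed.

End StepFunctions.

(** * Composition with continuous maps, and separability *)

Section Approximable.
Context {R : realType}.

Definition approx (T : Type) (d : T -> T -> R) (f : R -> T) : Prop :=
  forall e, 0 < e -> exists2 s, step s & fclose d e f s.

Section OneMetric.
Context (T : Type) (d : T -> T -> R).
Hypothesis dM : complete_metric d.

Lemma step_approx s : step s -> approx d s.
Proof. by move=> ss e e0; exists s => //; apply: (fclose_refl dM); exact: ltW. Qed.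

Lemma approx_near f : (forall e, 0 < e -> exists2 g, approx d g & fclose d e f g) ->
  approx d f.
Proof.
move=> fg e e0; have e20 : 0 < e / 2 by rewrite divr_gt0.
have [g /(_ _ e20)[s ss gs] fg'] := fg _ e20; exists s => //.
by rewrite (splitr e); exact: fclose_tri fg' gs.
Qed.

End OneMetric.

Definition fcontinuous (T U : Type) (d : T -> T -> R) (d' : U -> U -> R)
    (p : T -> U) : Prop :=
  forall x e, 0 < e -> exists2 r, 0 < r & forall y, d x y < r -> d' (p x) (p y) < e.

Section UniformContinuity.
Context (T U : Type) (d : T -> T -> R) (d' : U -> U -> R) (p : T -> U).
Hypotheses (dM : complete_metric d) (dM' : complete_metric d').
Hypothesis pc : fcontinuous d d' p.

(** Only y is confined to A: z will be a value of an arbitrary nearby function. *)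
Let unif e r (A : set T) :=
  forall y z, A y -> d y z < r -> d' (p y) (p z) <= e.

(* The hypothesis on K is total boundedness: a nested sequence of pieces of K of
   vanishing diameter on which uniformity fails would shrink to a point of
   discontinuity of p. *)
Let unif_totally_bounded (e : R) (eta : nat -> R) (I : nat -> finType)
    (w : forall k, I k -> T) (K : set T) : 0 < e ->
  (forall k, eta k * 4 <= 2 ^- k) ->
  (forall y, K y -> forall k, exists i, d y (w k i) <= eta k) ->
  exists2 r, 0 < r & unif e r K.
Proof.
move=> e0 etak Kw; apply: contrapT => nK.
pose P (k : nat) (A : set T) := A `<=` K /\ ~ exists2 r, 0 < r & unif e r A.
pose Q (k : nat) (A B : set T) :=
  B `<=` A /\ exists c, forall y, B y -> d y c <= eta k.
have [|k A [AK nA]|A [_ AP]] := @dep_choice _ P Q K; first by split.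
  apply: contrapT => nB; apply: nA.
  (* If uniformity held on each of the finitely many pieces of A, the least radius would serve for
     A. *)
  have H i : exists r, 0 < r /\ unif e r [set y | A y /\ d y (w k i) <= eta k].
    apply: contrapT => nr; apply: nB.
    exists [set y | A y /\ d y (w k i) <= eta k]; split.
      split; first by move=> y [/AK].
      by move=> [r r0 ur]; apply: nr; exists r.
    by split=> [y []//|]; exists (w k i) => y [].
  have [r rP] := choice H.
  exists (\big[Num.min/1]_i r i).
    by apply/bigmin_gtP; split=> // i _; have [] := rP i.
  move=> y z Ay /bigmin_gtP [_ yz].
  have [i yi] := Kw y (AK y Ay) k.
  by have [_] := rP i; apply; [split|exact: yz].
(* Uniformity holds vacuously on the empty set, so the pieces where it fails are inhabited. *)
have AS k : exists y, A k.+1 y.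
  apply: contrapT => nAk; have [[_ nu] _] := AP k.+1; apply: nu; exists 1 => //.
  by move=> y z Ay; exfalso; apply: nAk; exists y.
have [v vP] := choice AS.
have AAk k m : A (k + m)%N `<=` A k.
  elim: m => [|m IH]; first by rewrite addn0.
  by rewrite addnS => y; have [_ [Am _]] := AP (k + m)%N; move=> /Am/IH.
have diam k y z : A k.+1 y -> A k.+1 z -> d y z <= eta k * 2.
  have [_ [_ [c cP]]] := AP k; move=> /cP yc /cP zc.
  by have := cm_tri dM c y z; rewrite (cm_sym dM c); lra.
have [|l vl] := cm_lim dM (u := v).
  move=> k; have := diam k (v k) (v k.+1) (vP k).
  have [_ [Ak _]] := AP k.+1; move/(_ (Ak _ (vP k.+1))).
  by have := etak k; have := @halfpow_gt0 R k; lra.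
have [|r r0 lr] := @pc l (e / 2); first by rewrite divr_gt0.
have [|k kr] := @halfpow_lt R (r / 6); first by rewrite divr_gt0.
have [[_ nu] _] := AP k.+1; apply: nu; exists (r / 2); first by rewrite divr_gt0.
move=> y z Ay yz.
have ly : d l y < r / 2.
  have := diam k y (v k) Ay (vP k); have := vl k; have := cm_tri dM (v k) l y.
  rewrite (cm_sym dM l (v k)) (cm_sym dM y).
  by have := etak k; have := @halfpow_gt0 R k; lra.
have lz : d l z < r by have := cm_tri dM y l z; lra.
have := lr y _; have := lr z lz; have ly' : d l y < r by lra.
move=> + /(_ ly'); have := cm_tri dM' (p l) (p y) (p z).
by rewrite (cm_sym dM' (p y) (p l)); lra.
Qed.

(** Outside a small set, f takes values in the totally bounded set [K] of points near the finite
    range of every approximating step function, and p is uniformly continuous at the points of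
    [K]. *)
Lemma fclose_comp f (e : R) : approx d f -> 0 < e ->
  exists2 r, 0 < r & forall g, fclose d r f g -> fclose d' e (p \o f) (p \o g).
Proof.
move=> af e0.
(* The exceptional sets add up to at most e/2, and the bound 1/2 gives 4 * [eta k] at most 2^-k. *)
pose eta k := Num.min (e / 2) (1 / 2) * 2 ^- k.+1 : R.
have m0 : 0 < Num.min (e / 2) (1 / 2) :> R by rewrite lt_min !divr_gt0.
have eta0 k : 0 < eta k by rewrite mulr_gt0// halfpow_gt0.
have H k : exists s, step s /\ fclose d (eta k) f s.
  by have [s ss fs] := af _ (eta0 k); exists s.
have [s sP] := choice H.
have H' k : exists Iw : {I : finType & I -> T},
    forall x, exists i, s k x = projT2 Iw i.
  have [/step_cuts[n [l [w lw]]] _] := sP k.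
  by exists (existT _ (n.-tuple bool : finType) w) => x; exists (cuts l x).
have [Iw IwP] := choice H'.
pose K : set T := [set y | forall k, exists i, d y (projT2 (Iw k) i) <= eta k].
have [||r r0 rK] := @unif_totally_bounded e eta _ (fun k => projT2 (Iw k)) K e0.
- move=> k; rewrite (halfpowS k) /eta.
  have := @halfpow_gt0 R k.+1; have : Num.min (e / 2) (1 / 2) <= 1 / 2 :> R.
    by rewrite ge_min lexx orbT.
  nra.
- by move=> y Ky k; exact: Ky.
(* Halving turns the weak inequality outside the exceptional set into the strict one that [rK] asks
   for. *)
exists (Num.min r (e / 2) / 2); first by rewrite divr_gt0// lt_min r0 divr_gt0.
move=> g fg.
have sB : small (\bigcup_k [set x | eta k < d (f x) (s k x)])
    (Num.min (e / 2) (1 / 2)).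
  apply: small_bigcup => [|k]; first exact: ltW.
  by have [] := sP k.
have mr : Num.min r (e / 2) <= r by rewrite ge_min lexx.
have me : Num.min r (e / 2) <= e / 2 by rewrite ge_min lexx orbT.
have mn0 : 0 < Num.min r (e / 2) by rewrite lt_min r0 divr_gt0.
have me' : Num.min (e / 2) (1 / 2) <= e / 2 :> R by rewrite ge_min lexx.
have : small (\bigcup_k [set x | eta k < d (f x) (s k x)] `|`
    [set x | Num.min r (e / 2) / 2 < d (f x) (g x)]) e.
  by apply: small_le (smallU sB fg); lra.
apply: small_sub => x /= pfg; apply: contrapT => /not_orP[nB /negP].
rewrite -leNgt => fgx; move: pfg; rewrite ltNge => /negP; apply.
apply: rK; last by lra.
move=> k; have [i si] := IwP k x; exists i; rewrite -si leNgt; apply/negP => fs.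
by apply: nB; exists k.
Qed.

Lemma approx_comp f : approx d f -> approx d' (p \o f).
Proof.
move=> af e e0; have [r r0 fr] := fclose_comp af e0.
have [s ss fs] := af r r0.
by exists (p \o s); [exact: step_comp|exact: fr].
Qed.

End UniformContinuity.

Section Families.
Context (T : Type) (d : T -> T -> R) (n : nat).
Hypothesis dM : complete_metric d.

Lemma small_family (A : 'I_n -> set R) e :
  (forall i, small (A i) e) -> small [set x | exists i, A i x] (n%:R * e).
Proof.
move=> Ae; have H (l : seq 'I_n) :
    small [set x | exists2 i, i \in l & A i x] ((size l)%:R * e).
  elim: l => [|i l IH]; first by rewrite mul0r; apply: small_sub (small0 _) => // x [].
  rewrite /= -add1n natrD mulrDl mul1r; apply: small_sub (smallU (Ae i) IH) => x [j].
  by rewrite inE => /orP[/eqP -> |jl] Aj; [left|right; exists j].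
have := H (enum 'I_n); rewrite size_enum_ord; apply: small_sub => x [i Ai].
by exists i => //; rewrite mem_enum.
Qed.

(** The exceptional sets of the coordinates add up; the factor is at least 1 for every n, so it also
    covers the distance bound e. *)
Lemma fclose_family (f g : 'I_n -> R -> T) e : 0 < e ->
    (forall i, fclose d e (f i) (g i)) ->
  fclose (dsup d) (n.+1%:R * e) (fun x i => f i x) (fun x i => g i x).
Proof.
move=> e0 /small_family fg; apply: small_le (small_sub _ fg).
  by rewrite ler_wpM2r ?ler_nat// ltW.
move=> x /= ne; apply: contrapT => nx; move: ne; rewrite ltNge => /negP; apply.
have e1 : e <= n.+1%:R * e by rewrite ler_peMl ?ler1n// ltW.
apply/dsup_le => [|i]; first by rewrite mulr_ge0// ltW.
by rewrite (le_trans _ e1)// leNgt; apply/negP => ei; apply: nx; exists i.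
Qed.

Lemma approx_family (f : 'I_n -> R -> T) : (forall i, approx d (f i)) ->
  approx (dsup d) (fun x i => f i x).
Proof.
move=> af e e0; have en : 0 < e / n.+1%:R by rewrite divr_gt0.
have H i : exists s, step s /\ fclose d (e / n.+1%:R) (f i) s.
  by have [s ss fs] := af i _ en; exists s.
have [s sP] := choice H; exists (fun x i => s i x).
  by apply: step_family => i; have [] := sP i.
have -> : e = n.+1%:R * (e / n.+1%:R) by rewrite mulrCA divff ?mulr1// pnatr_eq0.
by apply: fclose_family => // i; have [] := sP i.
Qed.

End Families.

(** Countably many step functions have rational thresholds and values in the dense sequence. Moving
    each threshold to a rational slightly to its right changes the comparisons only on short
    intervals. *)
Lemma dense_step_seq (T : Type) (d : T -> T -> R) (u : nat -> T) :
    complete_metric d -> dense_seq d u ->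
  exists r : nat -> R -> T, (forall k, step (r k)) /\
    forall f e, approx d f -> 0 < e -> exists k, fclose d e f (r k).
Proof.
move=> dM du.
pose J : countType := {n : nat & (n.-tuple rat * {ffun n.-tuple bool -> nat})%type}.
pose ev (j : J) (x : R) : T := u ((projT2 j).2 (cuts (map_tuple ratr (projT2 j).1) x)).
have ev_step j : step (ev j).
  exists (map ratr (projT2 j).1) => x y xy; rewrite /ev; congr (u (_ _)).
  apply: eq_from_tnth => i; rewrite !tnth_mktuple; apply: xy.
  by rewrite tnth_map map_f// mem_tnth.
exists (fun k => if unpickle k is Some j then ev j else fun=> u 0%N); split.
  by move=> k; case: unpickle => [j|]; [exact: ev_step|exact: step_cst].
suff H f e : step f -> 0 < e -> exists j, fclose d e f (ev j).
  move=> f e af e0; have e20 : 0 < e / 2 by rewrite divr_gt0.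
  have [s ss fs] := af _ e20; have [j sj] := H s _ ss e20.
  by exists (pickle j); rewrite pickleK (splitr e); exact: fclose_tri fs sj.
move=> /step_cuts[n [l [w fw]]] e0.
have en : 0 < e / n.+1%:R by rewrite divr_gt0.
have Hq i : exists q : rat, tnth l i < ratr q < tnth l i + e / n.+1%:R.
  have [|q] := @rat_in_itvoo R (tnth l i) (tnth l i + e / n.+1%:R).
    by rewrite ltrDl.
  by rewrite in_itv => lq; exists q.
have [q qP] := choice Hq.
have Hv m : exists k, d (w m) (u k) < e by exact: du.
have [v vP] := choice Hv.
pose j : J := existT _ n ([tuple q i | i < n], [ffun m => v m]).
exists j.
have : small [set x | exists i, tnth l i <= x < ratr (q i)] (n%:R * (e / n.+1%:R)).
  apply: small_family => i; have /andP[lq ql] := qP i.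
  by apply: small_le (small_itv (ltW lq)); rewrite lerBlDl ltW.
have ne : n%:R * (e / n.+1%:R) <= e.
  rewrite mulrCA -[leRHS]mulr1 ler_pM2l// ler_pdivrMr ?ltr0Sn// mul1r ler_nat.
  exact: leqnSn.
move=> /(small_le ne); apply: small_sub.
move=> x /= fe; apply: contrapT => nx; move: fe; rewrite ltNge => /negP; apply.
have -> : f x = w (cuts l x) by exact: fw.
have -> : ev j x = u (v (cuts l x)).
  rewrite /ev/= ffunE; congr (u (v _)); apply: eq_from_tnth => i.
  rewrite !tnth_mktuple tnth_map tnth_mktuple.
  have /andP[lq _] := qP i.
  have [xl|lx] := ltP x (tnth l i); first by rewrite (lt_trans xl).
  by apply/negbTE/negP => xq; apply: nx; exists i; rewrite lx.
exact: ltW.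
Qed.

End Approximable.

Section LiftToFunctions.
Context {R : realType}.

(** Where f and g differ, their distance exceeds e * 2^-(k+1) for some k, and these sets have total
    size at most e for every e. *)
Lemma eqv_ne (T : Type) (d : T -> T -> R) (dM : complete_metric d) f g :
  eqv d f g <-> small [set x | f x <> g x] 0.
Proof.
split=> [fg|fg e e0]; last first.
  apply: small_sub (small_le (ltW e0) fg) => x /= ed fgx; move: ed.
  by rewrite fgx (cm_xx dM) ltNge ltW.
apply: small_limit => e e0; rewrite add0r.
have : small (\bigcup_k [set x | e * 2 ^- k.+1 < d (f x) (g x)]) e.
  by apply: small_bigcup => [|k]; [exact: ltW|apply: fg; rewrite mulr_gt0// halfpow_gt0].
apply: small_sub => x /= fgx.
have d0 : 0 < d (f x) (g x).
  rewrite lt_neqAle (cm_ge0 dM) andbT eq_sym; apply/eqP => /(cm_eq dM); exact: fgx.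
have [k kd] := halfpow_lt (divr_gt0 d0 e0).
exists k => //=; rewrite mulrC -ltr_pdivlMr//; apply: le_lt_trans kd.
exact: halfpow_le (leqnSn k).
Qed.

(** Equality almost everywhere passes through any p, since outside a null set the arguments
    coincide. *)
Lemma eqv_comp2 (T U : Type) (d : T -> T -> R) (d' : U -> U -> R)
    (p : T -> T -> U) f f' g g' : complete_metric d -> complete_metric d' ->
  eqv d f f' -> eqv d g g' ->
  eqv d' (fun x => p (f x) (g x)) (fun x => p (f' x) (g' x)).
Proof.
move=> dM dM' /(eqv_ne dM) ff' /(eqv_ne dM) gg'; apply/(eqv_ne dM').
have := smallU ff' gg'; rewrite addr0; apply: small_sub => x /= pne.
by apply: contrapT => /not_orP[/contrapT fx /contrapT gx]; apply: pne; rewrite fx gx.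
Qed.

End LiftToFunctions.

(** * The topological group L^0([0, 1]; G) *)

Section CompatibleMetric.
Context {R : realType}.

(** Bundling the metric with its properties lets the type [L0 d] determine all that its canonical
    structures depend on. *)
Record compatible_metric (G : topologicalType) := CompatibleMetric {
  cmet :> G -> G -> R ;
  cmet_complete : complete_metric cmet ;
  cmet_metrizes : metrizes cmet }.

Context (G : topologicalGroupType) (d : compatible_metric G).
Let dM := cmet_complete d.
Let dT := cmet_metrizes d.

(** Pairs are families over ['I_2], so that multiplication is a map out of a space with the metric
    [dsup]. *)
Definition pair2 (T : Type) (a b : T) : 'I_2 -> T :=
  fun i => if i == ord0 then a else b.

Lemma mulg_fcontinuous :
  fcontinuous (dsup d) d (fun v : 'I_2 -> G => (v ord0 * v ord_max)%g).
Proof.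
move=> v e e0.
have /(mulg_continuous (v ord0, v ord_max))[[A B] /= [/dT[a a0 vA] /dT[b b0 vB]] AB] :
    nbhs (v ord0 * v ord_max)%g [set z | d (v ord0 * v ord_max)%g z < e].
  by apply/dT; exists e.
exists (Num.min a b); first by rewrite lt_min a0.
move=> w /dsup_lt vw; apply: (AB (w ord0, w ord_max)); split => /=.
  by apply: vA; apply: lt_le_trans (vw _ _) _; rewrite ?lt_min ?a0// ge_min lexx.
by apply: vB; apply: lt_le_trans (vw _ _) _; rewrite ?lt_min ?a0// ge_min lexx orbT.
Qed.

Lemma invg_fcontinuous : fcontinuous d d (fun x : G => x^-1%g).
Proof.
move=> x e e0.
have /(invg_continuous x)/dT[r r0 xr] : nbhs (x^-1)%g [set z | d x^-1%g z < e].
  by apply/dT; exists e.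
by exists r.
Qed.

Lemma approx_mul f g : approx d f -> approx d g ->
  approx d (fun x => f x * g x)%g.
Proof.
move=> af ag.
have afg : approx (dsup d) (fun x i => pair2 f g i x).
  by apply: approx_family => i; rewrite /pair2; case: ifP.
exact: approx_comp (dsup_complete_metric dM) dM mulg_fcontinuous _ afg.
Qed.

Lemma approx_inv f : approx d f -> approx d (fun x => (f x)^-1)%g.
Proof. exact: approx_comp dM dM invg_fcontinuous _. Qed.

Lemma fclose_mul f g (e : R) : approx d f -> approx d g -> 0 < e ->
  exists2 r, 0 < r & forall f' g', fclose d r f f' -> fclose d r g g' ->
    fclose d e (fun x => f x * g x)%g (fun x => f' x * g' x)%g.
Proof.
move=> af ag e0.
have afg : approx (dsup d) (fun x i => pair2 f g i x).
  by apply: approx_family => i; rewrite /pair2; case: ifP.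
have [r r0 H] := fclose_comp (dsup_complete_metric dM) dM mulg_fcontinuous afg e0.
(* The 3 is the factor n.+1 of [fclose_family] for n = 2. *)
exists (r / 3); first by rewrite divr_gt0.
move=> f' g' ff' gg'.
have := H (fun x i => pair2 f' g' i x); apply.
have -> : r = 3%:R * (r / 3) by lra.
apply: fclose_family; first by rewrite divr_gt0.
by move=> i; rewrite /pair2; case: ifP.
Qed.

End CompatibleMetric.

Section MeasurableFunctionGroup.
Context {R : realType} (G : topologicalGroupType).

(* L^0([0, 1]; G): classes, modulo equality almost everywhere on [0, 1], of the
   limits in measure of step functions. *)
Record L0 (d : @compatible_metric R G) := MkL0 {
  L0_class : set (R -> G) ;
  L0_classP : exists f, approx d f /\ L0_class = eqv d f }.

Context (d : @compatible_metric R G).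
Let dM := cmet_complete d.
Let dT := cmet_metrizes d.
Local Notation H := (L0 d).

Definition rep (h : H) : R -> G := projT1 (cid (L0_classP h)).

Lemma approx_rep h : approx d (rep h).
Proof. by rewrite /rep; case: cid => f []. Qed.

Definition toL0 f (af : approx d f) : H :=
  MkL0 (ex_intro _ f (conj af erefl)).

Lemma rep_toL0 f (af : approx d f) : eqv d f (rep (toL0 af)).
Proof.
by rewrite /rep; case: cid => g /= [_ ->]; exact: (eqv_refl dM).
Qed.

Lemma L0_eqP (h k : H) : eqv d (rep h) (rep k) -> h = k.
Proof.
rewrite /rep; case: cid => f /= [_ hf]; case: cid => g /= [_ kg] fg.
case: h k hf kg => [A PA] [B PB] /= Af Bg.
suff AB : A = B by move: PA PB; rewrite AB => PA PB; congr MkL0; exact: Prop_irrelevance.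
rewrite Af Bg; apply/seteqP; split=> k; apply: (eqv_tri dM); first exact: (eqv_sym dM).
exact: fg.
Qed.

Definition L0mul (h k : H) : H :=
  toL0 (approx_mul (approx_rep h) (approx_rep k)).
Definition L0one : H := toL0 (step_approx dM (step_cst 1%g)).
Definition L0inv (h : H) : H := toL0 (approx_inv (approx_rep h)).

Lemma rep_mul h k : eqv d (rep (L0mul h k)) (fun x => rep h x * rep k x)%g.
Proof. exact/(eqv_sym dM)/rep_toL0. Qed.

Lemma rep_inv h : eqv d (rep (L0inv h)) (fun x => (rep h x)^-1)%g.
Proof. exact/(eqv_sym dM)/rep_toL0. Qed.

Lemma rep_one : eqv d (rep L0one) (fun=> 1%g).
Proof. exact/(eqv_sym dM)/rep_toL0. Qed.

Let eqv_mul f f' g g' : eqv d f f' -> eqv d g g' ->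
  eqv d (fun x => f x * g x)%g (fun x => f' x * g' x)%g.
Proof. exact: (eqv_comp2 (fun a b : G => a * b)%g dM dM). Qed.

(** This and the next laws hold pointwise in G and are carried to the chosen representatives by
    equality almost everywhere. *)
Fact L0mulA : associative L0mul.
Proof.
move=> h k l; apply: L0_eqP; apply: (eqv_tri dM (rep_mul _ _)).
apply: (eqv_tri dM (eqv_mul (eqv_refl dM _) (rep_mul _ _))).
apply: (eqv_sym dM); apply: (eqv_tri dM (rep_mul _ _)).
apply: (eqv_tri dM (eqv_mul (rep_mul _ _) (eqv_refl dM _))).
have -> : (fun x => rep h x * rep k x * rep l x)%g = (fun x => rep h x * (rep k x * rep l x))%g.
  by apply/funext => x; rewrite mulgA.
exact: (eqv_refl dM).
Qed.

Fact L0mul1g : left_id L0one L0mul.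
Proof.
move=> h; apply: L0_eqP; apply: (eqv_tri dM (rep_mul _ _)).
apply: (eqv_tri dM (eqv_mul rep_one (eqv_refl dM _))).
have -> : (fun x => 1 * rep h x)%g = rep h by apply/funext => x; rewrite mul1g.
exact: (eqv_refl dM).
Qed.

Fact L0mulg1 : right_id L0one L0mul.
Proof.
move=> h; apply: L0_eqP; apply: (eqv_tri dM (rep_mul _ _)).
apply: (eqv_tri dM (eqv_mul (eqv_refl dM _) rep_one)).
have -> : (fun x => rep h x * 1)%g = rep h by apply/funext => x; rewrite mulg1.
exact: (eqv_refl dM).
Qed.

Fact L0mulVg : left_inverse L0one L0inv L0mul.
Proof.
move=> h; apply: L0_eqP; apply: (eqv_tri dM (rep_mul _ _)).
apply: (eqv_tri dM (eqv_mul (rep_inv _) (eqv_refl dM _))).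
have -> : (fun x => (rep h x)^-1 * rep h x)%g = fun=> 1%g.
  by apply/funext => x; rewrite mulVg.
exact: (eqv_sym dM rep_one).
Qed.

Fact L0mulgV : right_inverse L0one L0inv L0mul.
Proof.
move=> h; apply: L0_eqP; apply: (eqv_tri dM (rep_mul _ _)).
apply: (eqv_tri dM (eqv_mul (eqv_refl dM _) (rep_inv _))).
have -> : (fun x => rep h x * (rep h x)^-1)%g = fun=> 1%g.
  by apply/funext => x; rewrite mulgV.
exact: (eqv_sym dM rep_one).
Qed.

HB.instance Definition _ := gen_eqMixin H.
HB.instance Definition _ := gen_choiceMixin H.
HB.instance Definition _ := isPointed.Build H L0one.
HB.instance Definition _ :=
  isGroup.Build H L0mulA L0mul1g L0mulg1 L0mulVg L0mulgV.

Definition L0dist (h k : H) : R := ldist d (rep h) (rep k).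

Fact L0distxx h : L0dist h h = 0.
Proof. by apply/ldist_eqv; exact: (eqv_refl dM). Qed.

Fact L0dist_eq0 h k : L0dist h k = 0 -> h = k.
Proof. by move/ldist_eqv/L0_eqP. Qed.

Fact L0dist_sym h k : L0dist h k = L0dist k h.
Proof. exact: (ldist_sym dM). Qed.

Fact L0dist_tri k h l : L0dist h l <= L0dist h k + L0dist k l.
Proof. exact: (ldist_tri dM). Qed.

HB.instance Definition _ :=
  isMetric.Build R H L0distxx L0dist_eq0 L0dist_sym L0dist_tri.

Lemma L0_mdist_lt (h k : H) e : mdist h k < e -> fclose d e (rep h) (rep k).
Proof. exact: ldist_lt. Qed.

Lemma L0_mdist_le (h k : H) e : 0 <= e -> fclose d e (rep h) (rep k) ->
  mdist h k <= e.
Proof. exact: ldist_le. Qed.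

(** Each change of representative costs e/2; this is the source of the factors 2 in later
    estimates. *)
Lemma fclose_eqv e f f' g g' : 0 < e -> eqv d f f' -> eqv d g g' ->
  fclose d e f g -> fclose d (2 * e) f' g'.
Proof.
move=> e0 ff' gg' fg; have e20 : 0 < e / 2 by rewrite divr_gt0.
have -> : 2 * e = e / 2 + e + e / 2 by lra.
apply: (fclose_tri dM) (gg' _ e20); apply: (fclose_tri dM) fg.
exact: (fclose_sym dM) (ff' _ e20).
Qed.

Lemma L0_complete (F : set_system H) : ProperFilter F -> cauchy F -> cvg F.
Proof.
move=> PF /cauchyP Fc.
(* Consecutive balls meet, so with these radii consecutive centres are less than 2^-k apart. *)
have Fk k : exists h, F (ball (h : H) (2 ^- k.+2 : R)) by apply: Fc; exact: halfpow_gt0.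
have [h hF] := choice Fk.
have hS k : fclose d (2 ^- k) (rep (h k)) (rep (h k.+1)).
  apply: L0_mdist_lt.
  have [y [hy hy']] := filter_ex (filterI (hF k) (hF k.+1)).
  move: hy hy'; rewrite !ballEmdist/= => hy hy'.
  have := metric_triangle (h k) y (h k.+1); rewrite (metric_sym y).
  have := @halfpow_gt0 R k.+3; have := @halfpowS R k.+2.
  by have := @halfpowS R k.+1; have := @halfpowS R k; lra.
have [f fP] := fclose_limit dM hS.
have af : approx d f.
  apply: (approx_near dM) => e e0.
  have [|k ke] := @halfpow_lt R (e / 2); first by rewrite divr_gt0.
  exists (rep (h k)); first exact: approx_rep.
  by apply: (fclose_sym dM); apply: fclose_le (fP k); lra.
apply/cvg_ex; exists (toL0 af) => A /mdist_metrizes[e e0 fA].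
have [|k ke] := @halfpow_lt R (e / 8); first by rewrite divr_gt0.
apply: filterS (hF k) => y; rewrite ballEmdist/= => hy; apply: fA.
have : mdist (h k) (toL0 af) <= 2 * (2 * 2 ^- k).
  apply: L0_mdist_le; first by rewrite !mulr_ge0// ltW// halfpow_gt0.
  apply: fclose_eqv (eqv_refl dM _) (rep_toL0 af) (fP k).
  by rewrite mulr_gt0// halfpow_gt0.
have := metric_triangle (toL0 af) (h k) y; rewrite (metric_sym (toL0 af) (h k)).
have := @halfpow_le R k k.+2 (leqW (leqnSn k)); lra.
Qed.

HB.instance Definition _ := Uniform_isComplete.Build H L0_complete.

Fact L0mul_continuous : continuous (fun x : H * H => (x.1 * x.2)%g).
Proof.
move=> [h k] A /mdist_metrizes[e e0 hkA].
have [|r r0 hkr] := fclose_mul (approx_rep h) (approx_rep k) (e := e / 4).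
  by rewrite divr_gt0.
exists (ball h r, ball k r) => /=; first by split; exact: nbhsx_ballx.
move=> [h' k'] /= []; rewrite !ballEmdist => hh' kk'; apply: hkA.
apply: (@le_lt_trans _ _ (2 * (e / 4))); last by lra.
apply: L0_mdist_le; first by lra.
apply: fclose_eqv (hkr _ _ (L0_mdist_lt hh') (L0_mdist_lt kk')); rewrite ?divr_gt0//.
  exact: rep_toL0.
exact: rep_toL0.
Qed.

Fact L0inv_continuous : continuous (fun x : H => x^-1%g).
Proof.
move=> h A /mdist_metrizes[e e0 hA].
have [|r r0 hr] := fclose_comp dM dM (@invg_fcontinuous _ _ d) (approx_rep h) (e := e / 4).
  by rewrite divr_gt0.
apply/mdist_metrizes; exists r => // h' hh'; apply: hA.
apply: (@le_lt_trans _ _ (2 * (e / 4))); last by lra.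
apply: L0_mdist_le; first by lra.
apply: fclose_eqv (hr _ (L0_mdist_lt hh')); rewrite ?divr_gt0//.
  exact: rep_toL0.
exact: rep_toL0.
Qed.

HB.instance Definition _ :=
  Topological_Group_isTopologicalGroup.Build H L0mul_continuous L0inv_continuous.

End MeasurableFunctionGroup.

(** * Comeager diagonal conjugacy classes *)

Lemma mulg_cvg (G : topologicalGroupType) (T : Type) (F : set_system T)
    (FF : Filter F) (f g : T -> G) (a b : G) :
  f @ F --> a -> g @ F --> b -> (fun x => f x * g x)%g @ F --> (a * b)%g.
Proof.
exact: (@continuous2_cvg _ _ _ _ _ _ _ _ (fun x y : G => x * y)%g)
  (mulg_continuous (a, b)).
Qed.

Lemma invg_cvg (G : topologicalGroupType) (T : Type) (F : set_system T)
    (FF : Filter F) (f : T -> G) (a : G) :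
  f @ F --> a -> (fun x => (f x)^-1)%g @ F --> (a^-1)%g.
Proof.
move=> fa; apply: (@continuous_cvg _ _ _ F FF f (fun x : G => x^-1%g)) fa.
exact: invg_continuous.
Qed.

Section DiagonalConjugation.
Context (G : topologicalGroupType) (n : nat).
Implicit Types (x y : {ptws 'I_n -> G}) (g h : G).

Lemma diag_conj_mul g h x : diag_conj (g * h)%g x = diag_conj g (diag_conj h x).
Proof. by apply/funext => i; rewrite /diag_conj invgM !mulgA. Qed.

Lemma diag_conjK g x : diag_conj g^-1%g (diag_conj g x) = x.
Proof.
by apply/funext => i; rewrite /diag_conj invgK !mulgA mulVg mul1g -mulgA mulVg mulg1.
Qed.

Lemma conjugation_continuous : continuous (fun p : G * G => (p.1 * p.2 * p.1^-1)%g).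
Proof.
move=> p; apply: mulg_cvg; first exact: mulg_continuous.
by apply: invg_cvg; exact: cvg_fst.
Qed.

End DiagonalConjugation.

Section DiagonalConjugationMetric.
Context {R : realType} (G : topologicalGroupType) (d : @compatible_metric R G).
Context (n : nat).
Let dM := cmet_complete d.
Let dT := cmet_metrizes d.
Local Notation Y := {ptws 'I_n -> G}.
Implicit Types (x y : Y) (g h : G).

Let sM : complete_metric (dsup d : Y -> Y -> R) := dsup_complete_metric dM.
Let sT : @metrizes R Y (dsup d) := dsup_metrizes dM dT.

Lemma diag_conj_near g x (e : R) : 0 < e ->
  exists2 r, 0 < r & forall h y, d g h < r -> dsup d x y < r ->
    dsup d (diag_conj g x) (diag_conj h y) < e.
Proof.
move=> e0; have H i : exists r, 0 < r /\ forall h a, d g h < r -> d (x i) a < r ->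
    d (g * x i * g^-1)%g (h * a * h^-1)%g < e.
  have /(@conjugation_continuous G (g, x i))[[A B] /= [/dT[a a0 gA] /dT[b b0 xB]] AB] :
      nbhs (g * x i * g^-1)%g [set z | d (g * x i * g^-1)%g z < e].
    by apply/dT; exists e.
  exists (Num.min a b); split=> [|h y]; first by rewrite lt_min a0.
  rewrite !lt_min => /andP[ha _] /andP[_ yb]; apply: (AB (h, y)).
  by split; [exact: gA|exact: xB].
have [r rP] := choice H.
exists (\big[Num.min/1]_i r i).
  by apply/bigmin_gtP; split=> // i _; have [] := rP i.
move=> h y /bigmin_gtP[_ gh] xy; apply/dsup_lt => // i.
have [_] := rP i; apply; first exact: gh.
have : dsup d x y < r i by apply: lt_le_trans xy _; exact: bigmin_le.
exact/le_lt_trans/dsup_ub.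
Qed.

Lemma diag_conj_continuous g : continuous (diag_conj g : Y -> Y).
Proof.
move=> x A /sT[e e0 xA]; have [r r0 gr] := diag_conj_near g x e0.
apply/sT; exists r => // y xy; apply: xA; apply: gr => //.
by rewrite (cm_xx dM).
Qed.

Lemma comeager_orbit_dense x : comeager (diag_conj_orbit x) ->
  forall y (e : R), 0 < e -> exists g, dsup d y (diag_conj g x) < e.
Proof.
move=> [B [_ dB Bx]] y e e0.
have [z [yz /Bx[g _ gx]]] : [set z : Y | dsup d y z < e]^° `&` B !=set0.
  apply: dB; last exact: open_interior.
  by exists y; apply/sT; exists e.
by exists g; have := interior_subset yz; rewrite -gx.
Qed.

(* For a neighborhood W of 1, countably many translates of W g x cover the
   comeager orbit, hence by Baire category one of them is somewhere dense. *)
Lemma comeager_orbit_open (u : nat -> G) x g (r : R) : dense_seq d u ->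
    comeager (diag_conj_orbit x) -> 0 < r ->
  exists2 eta, 0 < eta & forall y, dsup d (diag_conj g x) y < eta ->
    forall e : R, 0 < e ->
      exists2 h, d g h < r & dsup d y (diag_conj h x) < e.
Proof.
move=> du [B [[F oF BF] dB Bx]] r0.
have mulc : continuous (fun p : G * G => (p.1^-1 * p.2 * g)%g).
  move=> p; apply: mulg_cvg; last exact: cvg_cst.
  by apply: mulg_cvg; [apply: invg_cvg; exact: cvg_fst|exact: cvg_snd].
(* This provides a neighborhood W of 1 such that all elements of W^-1 W g are within r of g. *)
have /(mulc (1, 1)%g)[[W1 W2] /= [nW1 nW2] W12] :
    nbhs (1^-1 * 1 * g)%g [set z | d g z < r].
  by rewrite invg1 !mul1g; apply/dT; exists r.
pose W := W1 `&` W2.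
have nW : nbhs (1%g : G) W by exact: filterI.
have WW a b : W a -> W b -> d g (a^-1 * b * g)%g < r.
  by move=> [Wa _] [_ Wb]; exact: (W12 (a, b)).
pose C k : set Y := [set diag_conj (u k * w * g)%g x | w in W].
(* Some [u k] is so close to h g^-1 that (u k)^-1 h g^-1 lies in W. *)
have orbitC : diag_conj_orbit x `<=` \bigcup_k C k.
  move=> _ [h _ <-]; pose h' := (h * g^-1)%g.
  have qc : continuous (fun q : G => (q^-1 * h')%g).
    by move=> q; apply: mulg_cvg; [exact: invg_continuous|exact: cvg_cst].
  have /(qc h')/dT[e e0 hW] : nbhs (h'^-1 * h')%g W by rewrite mulVg.
  have [k /hW Wk] := du h' e e0.
  exists k => //; exists ((u k)^-1 * h')%g => //.
  by rewrite mulgA mulgV mul1g /h' -mulgA mulVg mulg1.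
have [k [y0 Cy0]] : exists k, (closure (C k))^° !=set0.
  apply: contrapT => nC.
  have dC k : dense (~` closure (C k)).
    move=> O [z Oz] oO; apply: contrapT => OC; apply: nC; exists k, z.
    apply: (@filterS _ _ (nbhs_filter z) O); last exact: open_nbhs_nbhs.
    by move=> y Oy; apply: contrapT => nCy; apply: OC; exists y.
  have dF k : dense (F k).
    move=> O O0 oO; have [y [Oy]] := dB O O0 oO.
    by rewrite BF => /(_ k I) Fy; exists y.
  (* Interleaving the two families gives a point of the orbit outside every [C k], against
     [orbitC]. *)
  pose D k := if odd k then F k./2 else ~` closure (C k./2).
  have [|||y [_ yD]] := @complete_metric_Baire R Y (dsup d) sM sT D _ _ setT _ openT.
  - move=> k; rewrite /D; case: odd => //.
    by apply: closed_openC; exact: closed_closure.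
  - by move=> k; rewrite /D; case: odd.
  - by exists x.
  have By : B y.
    rewrite BF => k _; have := yD k.*2.+1 I.
    by rewrite /D /= odd_double /= uphalf_double.
  have [k _ /subset_closure Cky] := orbitC _ (Bx _ By).
  by have := yD k.*2 I; rewrite /D odd_double doubleK.
have [y [Cy0' [w0 Ww0 yE]]] : (closure (C k))^° `&` C k !=set0.
  have := interior_subset Cy0 _ (open_nbhs_nbhs (conj (open_interior _) Cy0)).
  by rewrite setIC.
pose q := (u k * w0)%g.
(* Conjugation by [q] carries g.x to a point of [C k] interior to its closure, hence a ball around
   g.x into that closure. Returning by [q^-1] turns u_k w g into w0^-1 w g. *)
have /(@diag_conj_continuous q (diag_conj g x))/sT[eta eta0 gx] :
    nbhs (diag_conj q (diag_conj g x)) (closure (C k)).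
  by rewrite -diag_conj_mul /q yE.
exists eta => // z /gx Cz e e0.
have /Cz : nbhs (diag_conj q z) [set t : Y | dsup d z (diag_conj q^-1%g t) < e].
  have /(@diag_conj_continuous q^-1%g (diag_conj q z)) :
      nbhs (diag_conj q^-1%g (diag_conj q z)) [set t : Y | dsup d z t < e].
    by rewrite diag_conjK; apply/sT; exists e.
  exact.
move=> [_ [[w Ww <-]]] /=; rewrite -diag_conj_mul => ze.
exists (w0^-1 * w * g)%g; first exact: WW.
by move: ze; rewrite /q invgM -!mulgA mulKg.
Qed.

End DiagonalConjugationMetric.

(** * The orbit of a constant tuple in L^0 *)

Section AmpleGenericsOfL0.
Context {R : realType} (G : topologicalGroupType) (d : @compatible_metric R G).
Context (u : nat -> G) (du : dense_seq d u).
Let dM := cmet_complete d.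
Local Notation H := (L0 d).

Definition stepL0 (s : R -> G) (ss : step s) : H := toL0 (step_approx dM ss).

Lemma rep_stepL0 s (ss : step s) : eqv d s (rep (stepL0 ss)).
Proof. exact: rep_toL0. Qed.

Lemma mdist_fclose (h k : H) f g (e : R) : 0 < e ->
  eqv d f (rep h) -> eqv d g (rep k) -> fclose d e f g -> mdist h k <= 2 * e.
Proof.
move=> e0 fh gk fg; apply: L0_mdist_le; first by rewrite mulr_ge0// ltW.
exact: fclose_eqv fg.
Qed.

Lemma dense_stepL0 : exists (r : nat -> R -> G) (rs : forall k, step (r k)),
  dense_seq (@mdist R H) (fun k => stepL0 (rs k)).
Proof.
have [r [rs rd]] := dense_step_seq dM du; exists r, rs => h e e0.
have [|k rk] := rd (rep h) (e / 4) (approx_rep h); first by rewrite divr_gt0.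
exists k; apply: (@le_lt_trans _ _ (2 * (e / 4))); last by lra.
apply: mdist_fclose rk; rewrite ?divr_gt0//; first exact: (eqv_refl dM).
exact: rep_stepL0.
Qed.

Context (n : nat) (x : {ptws 'I_n -> G}).

Let X : {ptws 'I_n -> H} := fun i => stepL0 (step_cst (x i)).
Let p (h : H) : {ptws 'I_n -> H} := diag_conj h X.

Let rep_p f h i : eqv d f (rep h) ->
  eqv d (fun t => diag_conj (f t) x i) (rep (p h i)).
Proof.
move=> fh; apply: (eqv_sym dM); apply: (eqv_tri dM (rep_mul _ _)).
apply: (eqv_comp2 (fun a b : G => a * b)%g dM dM).
  apply: (eqv_tri dM (rep_mul _ _)).
  apply: (eqv_comp2 (fun a b : G => a * b)%g dM dM); first exact: (eqv_sym dM).
  exact/(eqv_sym dM)/rep_stepL0.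
apply: (eqv_tri dM (rep_inv _)).
have hf := eqv_sym dM fh.
(* Inversion is treated as a binary operation with a dummy second argument. *)
exact: (eqv_comp2 (fun a _ : G => a^-1)%g dM dM hf hf).
Qed.

(** One e goes from y to s and one from s to the conjugate by c; passing to representatives doubles
    the sum. *)
Let mdist_p (y : {ptws 'I_n -> H}) (s : 'I_n -> R -> G) (c : R -> G)
    (sc : step c) (e : R) : 0 < e ->
    (forall i, fclose d e (rep (y i)) (s i)) ->
    (forall t, dsup d (fun i => s i t) (diag_conj (c t) x) < e) ->
  dsup (@mdist R H) y (p (stepL0 sc)) <= 4 * e.
Proof.
move=> e0 ys sx; apply/dsup_le => [|i]; first by rewrite mulr_ge0// ltW.
have -> : 4 * e = 2 * (e + e) by lra.
apply: mdist_fclose; [by rewrite addr_gt0|exact: (eqv_refl dM)| |].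
  exact: rep_p (rep_stepL0 sc).
apply: (fclose_tri dM) (ys i) _.
apply: small_sub (small0 (ltW e0)) => t /=; have /dsup_lt - /(_ e0 i) := sx t.
by move=> /lt_trans st /st; rewrite ltxx.
Qed.

Hypothesis orbit_comeager : comeager (diag_conj_orbit x).

Let p_dense (y : {ptws 'I_n -> H}) (e : R) : 0 < e ->
  exists h, dsup (@mdist R H) y (p h) < e.
Proof.
move=> e0; have e80 : 0 < e / 8 by rewrite divr_gt0.
have sP i : exists s, step s /\ fclose d (e / 8) (rep (y i)) s.
  by have [s ss ys] := approx_rep (y i) e80; exists s.
have [s /all_and2[ss ys]] := choice sP.
have [sel selP] := choice (fun v => comeager_orbit_dense d orbit_comeager v e80).
(* An arbitrary choice function [sel] composed with a step function is again a step function. *)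
have sc : step (fun t => sel (fun i => s i t)) := step_comp sel (step_family ss).
exists (stepL0 sc); apply: (@le_lt_trans _ _ (4 * (e / 8))); last by lra.
by apply: (mdist_p sc e80 ys) => t; exact: selP.
Qed.

Let p_cont (h : H) (e : R) : 0 < e -> exists2 r, 0 < r &
  forall h', mdist h h' < r -> dsup (@mdist R H) (p h) (p h') < e.
Proof.
move=> e0; pose dH : @compatible_metric R H :=
  CompatibleMetric (mdist_complete_metric H) (@mdist_metrizes R H).
have [r r0 hr] := diag_conj_near dH h X e0.
exists r => // h' hh'; apply: hr => //.
by rewrite (cm_xx (dsup_complete_metric (mdist_complete_metric H))).
Qed.

(* A step function takes finitely many values a, and the local density of the
   orbits V x with V a neighborhood of a holds uniformly over these. *)
Let p_open (r : R -> G) (rs : step r) (e0 : R) : 0 < e0 ->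
  nbhs (p (stepL0 rs))
    [set y : {ptws 'I_n -> H} | forall e : R, 0 < e ->
      exists2 h, mdist (stepL0 rs) h < e0 & dsup (@mdist R H) y (p h) < e].
Proof.
move=> e0_gt0; pose b := e0 / 8; have b0 : 0 < b by rewrite divr_gt0.
have [m [l [w rw]]] := step_cuts rs.
have etaE c : exists eta, 0 < eta /\
    forall y, dsup d (diag_conj (w c) x) y < eta -> forall e : R, 0 < e ->
      exists2 g, d (w c) g < b & dsup d y (diag_conj g x) < e.
  by have [eta] := comeager_orbit_open (w c) du orbit_comeager b0; exists eta.
have [etas etaP] := choice etaE.
pose eta := \big[Num.min/1]_c etas c.
have eta0 : 0 < eta by apply/bigmin_gtP; split=> // c _; have [] := etaP c.
pose N : R := n.+1%:R; have N1 : 1 <= N by rewrite ler1n.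
(* The first bound puts the values within 3 * [dl] < [eta]; the second keeps the n exceptional sets,
   of size 3 * [dl] each, below [b] in total. *)
pose dl := Num.min (eta / 4) (b / (N * 3)).
have N30 : 0 < N * 3 by rewrite mulr_gt0// (lt_le_trans ltr01).
have dl0 : 0 < dl by rewrite lt_min !divr_gt0.
have dl_eta : dl * 4 <= eta by rewrite -ler_pdivlMr// ge_min lexx.
have dl_b : N * (3 * dl) <= b.
  by rewrite mulrA mulrC -ler_pdivlMr// ge_min lexx orbT.
apply/(dsup_metrizes (mdist_complete_metric H) (@mdist_metrizes R H)).
exists dl => // y py e e_gt0.
pose a := Num.min dl (e / 8); have a0 : 0 < a by rewrite lt_min dl0 divr_gt0.
have ae : a * 8 <= e by rewrite -ler_pdivlMr// ge_min lexx orbT.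
have adl : a <= dl by rewrite ge_min lexx.
have sP i : exists s, step s /\ fclose d a (rep (y i)) s.
  by have [s ss ys] := approx_rep (y i) a0; exists s.
have [s /all_and2[ss ys]] := choice sP.
(* The conjugator depends on the cell and on the tuple: it is taken near the value of [r] on the
   cell when the tuple permits, and otherwise anywhere, by density of the orbit. *)
have selP (cv : m.-tuple bool * ('I_n -> G)) : exists g,
    dsup d cv.2 (diag_conj g x) < a /\
    (dsup d (diag_conj (w cv.1) x) cv.2 < eta -> d (w cv.1) g < b).
  have [near|far] := pselect (dsup d (diag_conj (w cv.1) x) cv.2 < eta).
    have [_ /(_ cv.2)] := etaP cv.1.
    have le_eta : eta <= etas cv.1 by exact: bigmin_le.
    move=> /(_ (lt_le_trans near le_eta) _ a0)[g wg vg].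
    by exists g.
  have [g vg] := comeager_orbit_dense d orbit_comeager cv.2 a0.
  by exists g.
have [sel selE] := choice selP.
have sc : step (fun t => sel (cuts l t, fun i => s i t)).
  apply: (@step2 _ _ _ _ (fun c v => sel (c, v))); last exact: step_family.
  exists l => t t' tt'; apply: eq_from_tnth => i; rewrite !tnth_mktuple.
  by apply: tt'; exact: mem_tnth.
exists (stepL0 sc); last first.
  apply: (@le_lt_trans _ _ (4 * a)); last by lra.
  by apply: (mdist_p sc a0 ys) => t; have [] := selE (cuts l t, fun i => s i t).
apply: (@le_lt_trans _ _ (2 * b)); last by rewrite /b; lra.
apply: mdist_fclose b0 (rep_stepL0 rs) (rep_stepL0 sc) _.
(* Passing from [y] to representatives gives 2 * [dl], and the approximation by [s] one more. *)
have close_s i : fclose d (3 * dl) (fun t => diag_conj (r t) x i) (s i).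
  have -> : 3 * dl = 2 * dl + dl by lra.
  apply: (fclose_tri dM) (fclose_le adl (ys i)).
  have /dsup_lt - /(_ dl0 i) /L0_mdist_lt := py.
  apply: fclose_eqv => //; last exact: (eqv_refl dM).
  exact/(eqv_sym dM)/rep_p/rep_stepL0.
have := small_family close_s; have Nn : n%:R * (3 * dl) <= b.
  apply: le_trans dl_b; rewrite ler_wpM2r ?ler_nat// mulr_ge0// ltW//.
move=> /(small_le Nn); apply: small_sub => t /= bt; apply: contrapT => nt.
move: bt; rewrite ltNge => /negP; apply; apply: ltW; rewrite rw.
have [_] := selE (cuts l t, fun i => s i t); apply => /=.
rewrite -rw; apply/dsup_lt => // i.
apply: (@le_lt_trans _ _ (3 * dl)); last by lra.
by rewrite leNgt; apply/negP => si; apply: nt; exists i.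
Qed.

(** The orbit of [X] is the range of [p], to which [comeager_range] applies. *)
Lemma L0_comeager_orbit : exists Y : {ptws 'I_n -> H}, comeager (diag_conj_orbit Y).
Proof.
have [r [rs rd]] := dense_stepL0; exists X.
have cH := mdist_complete_metric H; have mH := @mdist_metrizes R H.
have cY : complete_metric (dsup (@mdist R H) : {ptws 'I_n -> H} -> _ -> R).
  exact: dsup_complete_metric.
apply: (comeager_range cH rd cY (dsup_metrizes cH mH) p_cont p_dense).
by move=> k j; apply: p_open; exact: halfpow_gt0.
Qed.

End AmpleGenericsOfL0.

(** * Contractibility and embedding *)

Section TopologyOfL0.
Context {R : realType} (G : topologicalGroupType) (d : @compatible_metric R G).
Let dM := cmet_complete d.
Let dT := cmet_metrizes d.
Local Notation H := (L0 d).

Lemma L0_polish (u : nat -> G) : dense_seq d u -> polish R H.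
Proof.
move=> du; have [r [rs rd]] := dense_stepL0 du.
exists (L0 d : completeMetricType R); split.
  exact: dense_seq_separable (@mdist_metrizes R H) rd.
exists id; split; first by move=> h; exact: cvg_id.
by exists id; split => // h; exact: cvg_id.
Qed.

Definition cut (t : R) (f : R -> G) (x : R) : G := if x < t then 1%g else f x.

(** Exactly one of the two functions is cut only between s and t, on an interval shorter than e. *)
Lemma fclose_cut f g s t (e : R) : 0 < e -> fclose d e f g -> `|s - t| < e ->
  fclose d (2 * e) (cut s f) (cut t g).
Proof.
move=> e0 fg st.
have sm : small [set x | Num.min s t <= x < Num.max s t] e.
  have mM : Num.min s t <= Num.max s t by rewrite ge_min le_max lexx.
  apply: small_le (small_itv mM); apply: le_trans (ltW st).
  by case: (ltP s t) => _; [rewrite distrC|]; exact: ler_norm.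
have -> : 2 * e = e + e by lra.
apply: small_sub (smallU fg sm) => x /=.
rewrite /cut ge_min lt_max; case: (ltP x s) => xs; case: (ltP x t) => xt;
  rewrite ?(cm_xx dM) ?xs ?xt/=.
- lra.
- by move=> _; right; rewrite ?orbT.
- by move=> _; right.
- by move=> ?; left; lra.
Qed.

Lemma approx_cut t f : approx d f -> approx d (cut t f).
Proof.
move=> af e e0; have e20 : 0 < e / 2 by rewrite divr_gt0.
have [s ss fs] := af _ e20; exists (cut t s); first exact: step_cut.
have -> : e = 2 * (e / 2) by lra.
by apply: fclose_cut => //; rewrite subrr normr0.
Qed.

Lemma L0_contractible : contractible R H.
Proof.
pose F (z : H * R) : H := toL0 (approx_cut z.2 (approx_rep z.1)).
have Fc : continuous F.
  move=> [h t] A /mdist_metrizes[e e0 FA]; have e80 : 0 < e / 8 by rewrite divr_gt0.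
  exists (ball h (e / 8), ball t (e / 8)) => /=; first by split; exact: nbhsx_ballx.
  move=> [k s] /= []; rewrite ballEmdist => hk ts; apply: FA.
  apply: (@le_lt_trans _ _ (2 * (2 * (e / 8)))); last by lra.
  apply: mdist_fclose (rep_toL0 _) (rep_toL0 _) _; first by lra.
  exact: fclose_cut (L0_mdist_lt hk) ts.
(* Cutting at 0 changes nothing on [0, 1[, and cutting at 1 makes the function 1 there. *)
have small_out (A : set R) : (forall x, 0 <= x < 1 -> ~ A x) -> small A 0.
  move=> A01; rewrite /small.
  have -> : A `&` `[0, 1[%classic = set0.
    by apply/seteqP; split=> // x [Ax] /=; rewrite in_itv => /A01.
  by rewrite measure0.
exists (L0one d), F; split.
- exact: continuous_subspaceT.
- move=> h; apply: L0_eqP; apply: (eqv_tri dM (eqv_sym dM (rep_toL0 _))).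
  apply/(eqv_ne dM); apply: small_out => x /andP[x0 _] /=.
  by rewrite /cut ltNge x0.
- move=> h; apply: L0_eqP; apply: (eqv_tri dM (eqv_sym dM (rep_toL0 _))).
  apply: (eqv_tri dM _ (rep_toL0 _)).
  apply/(eqv_ne dM); apply: small_out => x /andP[_ x1] /=.
  by rewrite /cut x1.
Qed.

Definition cstL0 (g : G) : H := stepL0 d (step_cst g).

Lemma cstL0_mul : {morph cstL0 : g h / (g * h)%g}.
Proof.
move=> g h; apply: L0_eqP; apply: (eqv_sym dM); apply: (eqv_tri dM (rep_mul _ _)).
apply: (eqv_tri dM _ (rep_stepL0 d _)).
apply: (eqv_comp2 (fun a b : G => a * b)%g dM dM);
  exact: (eqv_sym dM (rep_stepL0 d _)).
Qed.

(** For constants the exceptional set is empty or everything, and the latter has measure 1, more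
    than 2 * e. *)
Lemma mdist_cstL0 (g h : G) (e : R) : e * 4 <= 1 ->
  mdist (cstL0 g) (cstL0 h) < e -> d g h <= 2 * e.
Proof.
move=> e1 gh; have e0 : 0 < e := le_lt_trans (mdist_ge0 _ _) gh.
have gh2 : fclose d (2 * e) (fun=> g) (fun=> h).
  by apply: fclose_eqv (L0_mdist_lt gh) => //; exact: (eqv_sym dM (rep_stepL0 d _)).
rewrite leNgt; apply/negP => egh.
have := @small_sub R setT [set x | 2 * e < d g h] (2 * e) (fun _ _ => egh) gh2.
by move/small_full_ge; lra.
Qed.

Lemma cstL0_embedding : topological_group_embedding cstL0.
Proof.
have gh0 g h (e : R) : mdist (cstL0 g) (cstL0 h) < Num.min (e / 4) (1 / 4) ->
    d g h < e.
  move=> gh; have e0 : 0 < Num.min (e / 4) (1 / 4) := le_lt_trans (mdist_ge0 _ _) gh.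
  have e1 : Num.min (e / 4) (1 / 4) <= e / 4 by rewrite ge_min lexx.
  have e2 : Num.min (e / 4) (1 / 4) <= 1 / 4 by rewrite ge_min lexx orbT.
  have /mdist_cstL0 : Num.min (e / 4) (1 / 4) * 4 <= 1 by lra.
  by move=> /(_ _ _ gh); lra.
have cst_inj : injective cstL0.
  move=> g h gh; apply/(cm_eq dM)/le_anti; rewrite (cm_ge0 dM) andbT.
  apply/ler_addgt0Pr => e e0; rewrite add0r ltW// gh0// gh mdistxx.
  by rewrite lt_min !divr_gt0.
split; [exact: cstL0_mul|exact: cst_inj|split].
  move=> g A /mdist_metrizes[e e0 gA]; apply/dT.
  exists (e / 4); first by rewrite divr_gt0.
  move=> h gh; apply: gA; apply: (@le_lt_trans _ _ (2 * (e / 4))); last by lra.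
  apply: mdist_fclose (rep_stepL0 d _) (rep_stepL0 d _) _; rewrite ?divr_gt0//.
  apply: small_sub (small0 _); last by rewrite ltW// divr_gt0.
  by move=> x /= /(lt_trans gh); rewrite ltxx.
(* The inverse on the range is extended by the default value 1. *)
have inv h : exists g, forall g', cstL0 g' = h -> g' = g.
  have [[g <-]|ng] := pselect (exists g, cstL0 g = h).
    by exists g => g' /cst_inj.
  by exists 1%g => g' gh; exfalso; apply: ng; exists g'.
have [f fP] := choice inv.
have fK : cancel cstL0 f by move=> g; rewrite -(fP (cstL0 g) g erefl).
exists f; split=> //; apply/subspace_continuousP => _ [g _ <-] A.
rewrite /from_subspace fK => /dT[e e0 gA].
apply/mdist_metrizes; exists (Num.min (e / 4) (1 / 4)).
  by rewrite lt_min !divr_gt0.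
by move=> k gk [h _ hk]; move: gk; rewrite -hk /= fK => /gh0/gA.
Qed.

End TopologyOfL0.

Theorem theorem1 (R : realType) (G : topologicalGroupType)
  (polishG : polish R G) (ampleG : ample_generics G) :
  exists H : topologicalGroupType,
    [/\ polish R H, contractible R H, ample_generics H
      & exists f : G -> H, topological_group_embedding f].
Proof.
have [d [dM dT [u du]]] := polish_metric polishG.
pose D := CompatibleMetric dM dT; have duD : dense_seq D u by [].
exists (L0 D); split.
- exact: L0_polish duD.
- exact: L0_contractible.
- by move=> n; have [x ox] := ampleG n; have := L0_comeager_orbit duD ox; exact.
- by exists (cstL0 D); exact: cstL0_embedding.
Qed.
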